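(* Suppose $\langle Q^n\rangle_{n\ge0}$ is an infinite sequence of pentaforms such that for all $n\ge1$, $Q^{n-1}\subseteq Q^n$ and $r^n=r^0$, where $r^n$ denotes the root node of $Q^n$. Then $\bigcup_{n\ge0}Q^n$ is a pentaform with root $r^0$.
   Context: A quintuple $\langle i,j,w,a,y\rangle$ has arbitrary objects as components, called player, situation, decision node, action, successor node. Decision nodes and successor nodes are both nodes (the same object may occur as both). A quintuple set $Q$ is a (possibly infinite) set of quintuples. For a string of letters from $I,J,W,A,Y$, $\pi_{\cdots}(Q)$ is the projection of $Q$ onto those coordinates, in the order listed, e.g. $\pi_{JI}(Q)=\{\langle j,i\rangle\mid \exists w,a,y:\ \langle i,j,w,a,y\rangle\in Q\}$. Write $J=\pi_J(Q)$, $W=\pi_W(Q)$, $Y=\pi_Y(Q)$. For $j\in J$, the slice is $Q_j=\{\langle i_*,j_*,w_*,a_*,y_*\rangle\in Q\mid j_*=j\}$. A function is a set $f$ of couples such that $\langle x,z\rangle,\langle x,z'\rangle\in f$ implies $z=z'$. A pentaform is a quintuple set $Q$ such that: [Pij] $\pi_{JI}(Q)$ is a function; [Pjw] $\pi_{WJ}(Q)$ is a function; [Pwa] for all $j\in J$, $\pi_{WA}(Q_j)$ is a Cartesian product; [Pway] $\{\langle\langle w,a\rangle,y\rangle\mid\langle w,a,y\rangle\in\pi_{WAY}(Q)\}$ is a function; [Pwy] $\pi_{YW}(Q)$ is a function, denoted $p$; [Pay] $\pi_{YA}(Q)$ is a function; [Py] for every $y\in Y$ there is $m\ge1$ with $p^m(y)\notin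 Y$ (iterates of $p$ from $y$ eventually leave $Y$); [Pr] $W\smallsetminus Y$ is a singleton. The root node $r$ of a pentaform $Q$ is defined by $\{r\}=W\smallsetminus Y$. *)

(* Defs.v *)
From mathcomp Require Import all_boot.
From mathcomp Require Import classical_sets.

Set Implicit Arguments.
Unset Strict Implicit.
Unset Printing Implicit Defensive.

Local Open Scope classical_set_scope.

Definition is_function (X Z : Type) (f : set (X * Z)) : Prop :=
  forall x z z', f (x, z) -> f (x, z') -> z = z'.

Definition is_cartesian_product (X Z : Type) (R : set (X * Z)) : Prop :=
  exists (B : set X) (C : set Z), R = B `*` C.

(* [graph_iter f m (x, z)] says that the m-th iterate of the partial function
   with graph [f] is defined at [x] and that its value there is [z]. *)
Fixpoint graph_iter (X : Type) (f : set (X * X)) (m : nat) : set (X * X) :=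
  match m with
  | 0 => [set xz | xz.1 = xz.2]
  | m'.+1 => [set xz | exists2 u, graph_iter f m' (xz.1, u) & f (u, xz.2)]
  end.

(* Decision nodes and successor nodes share the type [N], since the same object
   may occur as both. The types are arbitrary, so they may coincide. *)
Record quintuple (I J N A : Type) : Type := Quintuple {
  player : I;
  situation : J;
  decision_node : N;
  action : A;
  successor_node : N
}.

Section Pentaform.
Variables I J N A : Type.
Implicit Type Q : set (quintuple I J N A).

Definition pi_J Q : set J := [set situation q | q in Q].
Definition pi_W Q : set N := [set decision_node q | q in Q].
Definition pi_Y Q : set N := [set successor_node q | q in Q].
Definition pi_JI Q : set (J * I) := [set (situation q, player q) | q in Q].
Definition pi_WJ Q : set (N * J) :=
  [set (decision_node q, situation q) | q in Q].
Definition pi_WA Q : set (N * A) := [set (decision_node q, action q) | q in Q].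
(* A triple (w, a, y) is the nested couple ((w, a), y), so that [pi_WAY Q] is
   also a set of couples with first component (w, a). *)
Definition pi_WAY Q : set (N * A * N) :=
  [set (decision_node q, action q, successor_node q) | q in Q].
Definition pi_YW Q : set (N * N) :=
  [set (successor_node q, decision_node q) | q in Q].
Definition pi_YA Q : set (N * A) :=
  [set (successor_node q, action q) | q in Q].

Definition slice Q (j : J) : set (quintuple I J N A) :=
  [set q | Q q /\ situation q = j].

Record pentaform Q : Prop := Pentaform {
  Pij : is_function (pi_JI Q);
  Pjw : is_function (pi_WJ Q);
  Pwa : forall j, pi_J Q j -> is_cartesian_product (pi_WA (slice Q j));
  Pway : is_function (pi_WAY Q);
  Pwy : is_function (pi_YW Q);
  Pay : is_function (pi_YA Q);
  Py : forall y, pi_Y Q y ->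
    exists m, (1 <= m)%N /\
      exists z, graph_iter (pi_YW Q) m (y, z) /\ ~ pi_Y Q z;
  Pr : exists r, pi_W Q `\` pi_Y Q = [set r]
}.

Definition is_root Q (r : N) : Prop := pi_W Q `\` pi_Y Q = [set r].

End Pentaform.

(* Main.v *)
Require Import Defs.
From mathcomp Require Import all_boot.
From mathcomp Require Import classical_sets.

(** Each axiom that constrains at most two quintuples at a time passes to the
    union, because two quintuples of the union of a chain lie in a common
    [Q n]; being a Cartesian product is such a condition, since it amounts to
    closure under exchanging second components. For [Py], iterating [p] from
    [y] leaves [Y n] at a decision node of [Q n], hence at the common root,
    which lies in no [Y k]. *)

Local Open Scope classical_set_scope.

(** For the converse, the factors are the two projections of [R]; this also covers an empty [R]. *)
Lemma is_cartesian_productP (X Z : Type) (R : set (X * Z)) :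
  is_cartesian_product R <->
  forall x z x' z', R (x, z) -> R (x', z') -> R (x, z').
Proof.
split=> [[B [C ->]] x z x' z' [Bx _] [_ Cz']|exR]; first by split.
exists (fst @` R), (snd @` R); apply/seteqP; split=> [[x z] Rxz|[x z]].
  by split; exists (x, z).
move=> [[[x1 z1] R1 /= <-] [[x2 z2] R2 /= <-]].
exact: exR R1 R2.
Qed.

Lemma chain_bigcup2 (T : Type) (F : nat -> set T) :
  {homo F : m n / (m <= n)%N >-> m `<=` n} ->
  forall s t, (\bigcup_n F n) s -> (\bigcup_n F n) t ->
  exists n, F n s /\ F n t.
Proof.
move=> F_mono s t [m _ Fs] [n _ Ft]; exists (maxn m n); split.
- exact: F_mono (leq_maxl m n) _ Fs.
- exact: F_mono (leq_maxr m n) _ Ft.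
Qed.

(** Keeping [f] arbitrary lets one argument serve all five functional axioms, whose projections are
    images of the quintuple set. *)
Lemma is_function_image_chain (T X Z : Type) (f : T -> X * Z)
    (F : nat -> set T) :
  {homo F : m n / (m <= n)%N >-> m `<=` n} ->
  (forall n, is_function (f @` F n)) ->
  is_function (f @` (\bigcup_n F n)).
Proof.
move=> F_mono F_fun x z z' [s Fs fs] [t Ft ft].
have [n [Fns Fnt]] := chain_bigcup2 _ _ F_mono _ _ Fs Ft.
by apply: (F_fun n x); [exists s | exists t].
Qed.

(** Carries an iterate found in a single [Q n] over to the union. *)
Lemma graph_iter_mono (X : Type) (f g : set (X * X)) m :
  f `<=` g -> graph_iter f m `<=` graph_iter g m.
Proof.
move=> fg; elim: m => [//|m IHm] [x z] [u xu uz].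
by exists u; [exact: IHm | exact: fg].
Qed.

Theorem proposition4p5 (I J N A : Type)
    (Q : nat -> set (quintuple I J N A)) (r : nat -> N)
    (Q_pentaform : forall n : nat, pentaform (Q n))
    (r_root : forall n : nat, is_root (Q n) (r n))
    (Q_r_step : forall n : nat, (1 <= n)%N ->
       Q (n - 1)%N `<=` Q n /\ r n = r 0%N) :
  pentaform (\bigcup_(n in [set: nat]) Q n) /\
  is_root (\bigcup_(n in [set: nat]) Q n) (r 0%N).
Proof.
have Q_mono : {homo Q : m n / (m <= n)%N >-> m `<=` n}.
  apply: homo_leq => [S //|S2 S1 S3|n]; first exact: subset_trans.
  by have [] := Q_r_step n.+1 isT; rewrite subn1.
have root0 n : is_root (Q n) (r 0).
  by case: n => [|n]; have := r_root _; last case: (Q_r_step n.+1 isT) => _ <-.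
have root_notin : ~ pi_Y (\bigcup_n Q n) (r 0).
  move=> [q [n _ Qq] qr].
  have [_] : (pi_W (Q n) `\` pi_Y (Q n)) (r 0) by rewrite (root0 n).
  by apply; exists q.
have rootE n w : pi_W (Q n) w -> ~ pi_Y (Q n) w -> w = r 0.
  by move=> Ww Yw; have : (pi_W (Q n) `\` pi_Y (Q n)) w by []; rewrite (root0 n).
have rootU : is_root (\bigcup_n Q n) (r 0).
  apply/seteqP; split=> [w [[q [n _ Qq] qw] Yw]|_ ->].
    (* A node outside the successor nodes of the union is outside those of [Q n]. *)
    apply: (rootE n); first by exists q.
    by move=> [q' Qq' q'w]; apply: Yw; exists q' => //; exists n.
  split=> //; have [[q Qq qr] _] : (pi_W (Q 0) `\` pi_Y (Q 0)) (r 0).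
    by rewrite (root0 0).
  by exists q => //; exists 0.
split=> //; split.
- by apply: is_function_image_chain => // n; apply: Pij.
- by apply: is_function_image_chain => // n; apply: Pjw.
- move=> j _; apply/is_cartesian_productP => w a w' a'.
  move=> [s [Us sj] sE] [t [Ut tj] tE].
  have [n [Qs Qt]] := chain_bigcup2 _ _ Q_mono _ _ Us Ut.
  have Jj : pi_J (Q n) j by exists s.
  have /is_cartesian_productP exch := Pwa (Q_pentaform n) Jj.
  have [q [Qq qj] qE] : pi_WA (slice (Q n) j) (w, a').
    by apply: (exch w a w' a'); [exists s | exists t].
  by exists q => //; split=> //; exists n.
- by apply: is_function_image_chain => // n; apply: Pway.
- by apply: is_function_image_chain => // n; apply: Pwy.
- by apply: is_function_image_chain => // n; apply: Pay.
- move=> y [q [n _ Qq] qy].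
  have Yy : pi_Y (Q n) y by exists q.
  have [m [m_gt0 [z [yz Yz]]]] := Py (Q_pentaform n) Yy.
  (* Since [m] is positive, the iterate has a last step, and this step makes [z] a decision node of
     [Q n]. *)
  case: m m_gt0 yz => [//|m] _ yz.
  exists m.+1; split=> //; exists z.
  (* A node that has left [pi_Y (Q n)] could a priori be a successor node of a later [Q k]; being
     the common root excludes this. *)
  have zr : z = r 0.
    apply: (rootE n) => //.
    by case: yz => u _ [q' Qq' [_ q'z]]; exists q'.
  split; last by rewrite zr.
  by apply: graph_iter_mono yz; apply: image_subset => q' Qq'; exists n.
- by exists (r 0).
Qed.
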